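(* Let $(X,d_X)$ and $(Y,d_Y)$ be semimetric spaces, and let $(X,\delta_X)$ and $(Y,\delta_Y)$ be their ordinal types. Then $(X,\delta_X)$ and $(Y,\delta_Y)$ are isomorphic if and only if $(X,d_X)$ and $(Y,d_Y)$ are weakly similar.
   Context: A semimetric on $X$ is a function $d\colon X\times X\to[0,\infty)$ with $d(x,y)=d(y,x)$ and ($d(x,y)=0\Leftrightarrow x=y$) for all $x,y\in X$; then $(X,d)$ is a semimetric space. The ordinal type $(X,\delta)$ of a semimetric space $(X,d)$ is given by the map $\delta\colon X^4\to\{\text{`}<\text{'},\text{`}=\text{'},\text{`}>\text{'}\}$, where $\delta(x,y,z,w)$ is `$<$', `$=$', or `$>$' according to whether $d(x,y)<d(z,w)$, $d(x,y)=d(z,w)$, or $d(x,y)>d(z,w)$. $(X,\delta_X)$ and $(Y,\delta_Y)$ are isomorphic if there exists a bijection $\Phi\colon X\to Y$ such that $\delta_X(x,y,z,w)=\delta_Y(\Phi(x),\Phi(y),\Phi(z),\Phi(w))$ for all $x,y,z,w\in X$. The spectrum of a semimetric space $(X,d)$ is $\operatorname{Sp}(X)=\{d(x,y)\colon x,y\in X\}$. Semimetric spaces $(X,d_X)$ and $(Y,d_Y)$ are weakly similar if there exist a bijection $\Phi\colon X\to Y$ and a strictly increasing bijection $f\colon\operatorname{Sp}(X)\to\operatorname{Sp}(Y)$ such that $f(d_X(x,y))=d_Y(\Phi(x),\Phi(y))$ for all $x,y\in X$. *)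

(* Defs.v *)
From mathcomp Require Import all_boot all_order all_algebra.
From mathcomp Require Import boolp classical_sets functions reals.

Set Implicit Arguments.
Unset Strict Implicit.
Unset Printing Implicit Defensive.

Import Order.TTheory GRing.Theory Num.Theory.

Local Open Scope classical_set_scope.
Local Open Scope ring_scope.

Record semimetric (R : realType) (X : Type) (d : X -> X -> R) : Prop := {
  semimetric_ge0 : forall x y, 0 <= d x y ;
  semimetric_sym : forall x y, d x y = d y x ;
  semimetric_eq0 : forall x y, d x y = 0 <-> x = y }.

(* [Lt], [Eq], [Gt] of [comparison] stand for '<', '=', '>'. *)
Definition ordinal_type (R : realType) (X : Type) (d : X -> X -> R)
    (x y z w : X) : comparison :=
  if d x y < d z w then Lt else if d x y == d z w then Eq else Gt.

Definition ordinal_isomorphic (X Y : Type)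
    (deltaX : X -> X -> X -> X -> comparison)
    (deltaY : Y -> Y -> Y -> Y -> comparison) : Prop :=
  exists2 Phi : X -> Y, bijective Phi &
    forall x y z w,
      deltaX x y z w = deltaY (Phi x) (Phi y) (Phi z) (Phi w).

Definition spectrum (R : realType) (X : Type) (d : X -> X -> R) : set R :=
  [set d x y | x in [set: X] & y in [set: X]].

(* A map Sp(X) -> Sp(Y) is represented by a function R -> R, of which only the
   restriction to Sp(X) matters. *)
Definition weakly_similar (R : realType) (X Y : Type)
    (dX : X -> X -> R) (dY : Y -> Y -> R) : Prop :=
  exists (Phi : X -> Y) (f : R -> R),
    [/\ bijective Phi,
        set_bij (spectrum dX) (spectrum dY) f,
        {in spectrum dX &, {homo f : s t / s < t}} &
        forall x y, f (dX x y) = dY (Phi x) (Phi y)].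

(* Main.v *)
Require Import Defs.
From mathcomp Require Import all_boot all_order all_algebra.
From mathcomp Require Import boolp classical_sets functions reals.

(** The ordinal type of a space records exactly which distances are smaller
    than, and which are equal to, which others (lemma [eq_ordinal_typeP]).
    A bijection [Phi] preserving equality of distances makes the rule
    [dX x y |-> dY (Phi x) (Phi y)] a well defined function on the spectrum of
    [dX] (lemma [factor_through_spectrum]); it is onto because [Phi] is, and it
    is strictly increasing because [Phi] preserves strict comparisons.
    Conversely, a strictly increasing function on a totally ordered set both
    preserves and reflects [<] and [=], so a weak similarity preserves the
    ordinal type. *)

Set Implicit Arguments.
Unset Strict Implicit.
Unset Printing Implicit Defensive.

Import Order.TTheory GRing.Theory Num.Theory.

Local Open Scope classical_set_scope.
Local Open Scope ring_scope.

(** [Gt] is the remaining case once [Lt] and [Eq] are decided, so agreement on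
    those two suffices. *)
Lemma eq_ordinal_typeP (R : realType) (X Y : Type) (dX : X -> X -> R)
    (dY : Y -> Y -> R) (x y z w : X) (x' y' z' w' : Y) :
  ordinal_type dX x y z w = ordinal_type dY x' y' z' w' <->
  (dX x y < dX z w) = (dY x' y' < dY z' w') /\
  (dX x y == dX z w) = (dY x' y' == dY z' w').
Proof.
rewrite /ordinal_type; split=> [|[-> ->]//].
by case: (ltgtP (dX x y)); case: (ltgtP (dY x' y')).
Qed.

Lemma spectrumP (R : realType) (X : Type) (d : X -> X -> R) (r : R) :
  spectrum d r <-> exists x y, d x y = r.
Proof.
split=> [[x _ [y _ <-]]|[x [y <-]]]; first by exists x, y.
by exists x => //; exists y.
Qed.

Lemma dist_in_spectrum (R : realType) (X : Type) (d : X -> X -> R) (x y : X) :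
  d x y \in spectrum d.
Proof. by apply/mem_set/spectrumP; exists x, y. Qed.

(** Used with [g x y := dY (Phi x) (Phi y)], this produces the rescaling of a
    weak similarity: its value at a distance is read off any pair of points
    realizing that distance. *)
Lemma factor_through_spectrum (R : realType) (X : Type) (d g : X -> X -> R) :
  (forall x y z w, d x y = d z w -> g x y = g z w) ->
  exists f : R -> R, forall x y, f (d x y) = g x y.
Proof.
move=> dg.
have [f fP] : {f : R -> R & forall r x y, d x y = r -> f r = g x y}.
  apply: (@choice _ _ (fun r s => forall x y, d x y = r -> s = g x y)) => r.
  have [[z [w <-]]|nr] := pselect (exists x y, d x y = r).
    by exists (g z w) => x y /dg.
  (* off the spectrum the value is arbitrary *)
  by exists 0 => x y dr; case: nr; exists x, y.
by exists f => x y; exact: fP.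
Qed.

Lemma ordinal_isomorphic_weakly_similar (R : realType) (X Y : Type)
    (dX : X -> X -> R) (dY : Y -> Y -> R) :
  ordinal_isomorphic (ordinal_type dX) (ordinal_type dY) ->
  weakly_similar dX dY.
Proof.
case=> Phi Phi_bij Phi_iso.
have ltE x y z w : (dX x y < dX z w) = (dY (Phi x) (Phi y) < dY (Phi z) (Phi w)).
  by have /eq_ordinal_typeP[] := Phi_iso x y z w.
have eqE x y z w :
    (dX x y == dX z w) = (dY (Phi x) (Phi y) == dY (Phi z) (Phi w)).
  by have /eq_ordinal_typeP[] := Phi_iso x y z w.
have [|f fE] :=
    @factor_through_spectrum _ _ dX (fun x y => dY (Phi x) (Phi y)).
  by move=> x y z w /eqP; rewrite eqE => /eqP.
exists Phi, f; split=> //; first split.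
- move=> _ /spectrumP[x [y <-]].
  by rewrite fE; apply/spectrumP; exists (Phi x), (Phi y).
- move=> _ _ /set_mem/spectrumP[x [y <-]] /set_mem/spectrumP[z [w <-]].
  by rewrite !fE => /eqP; rewrite -eqE => /eqP.
- case: Phi_bij => Psi _ PsiK _ /spectrumP[x [y <-]].
  exists (dX (Psi x) (Psi y)); last by rewrite fE !PsiK.
  exact/set_mem/dist_in_spectrum.
- move=> _ _ /set_mem/spectrumP[x [y <-]] /set_mem/spectrumP[z [w <-]].
  by rewrite !fE ltE.
Qed.

Lemma weakly_similar_ordinal_isomorphic (R : realType) (X Y : Type)
    (dX : X -> X -> R) (dY : Y -> Y -> R) :
  weakly_similar dX dY ->
  ordinal_isomorphic (ordinal_type dX) (ordinal_type dY).
Proof.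
case=> Phi [f [Phi_bij _ f_incr fE]]; exists Phi => // x y z w.
have f_le := le_mono_in f_incr.
apply/eq_ordinal_typeP; rewrite -!fE; split.
  by rewrite (leW_mono_in f_le) ?dist_in_spectrum.
by rewrite (inj_in_eq (inc_inj_in f_le)) ?dist_in_spectrum.
Qed.

Theorem proposition2p4 (R : realType) (X Y : Type)
    (dX : X -> X -> R) (dY : Y -> Y -> R)
    (hX : semimetric dX) (hY : semimetric dY) :
  ordinal_isomorphic (ordinal_type dX) (ordinal_type dY) <->
  weakly_similar dX dY.
Proof.
split; first exact: ordinal_isomorphic_weakly_similar.
exact: weakly_similar_ordinal_isomorphic.
Qed.
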